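(* Let $p$ be a prime, let $G=C_p\times C_p$, and let $\mathcal{P}$ be the partition of $\{1,2,\dots,p+1\}$ consisting of all singletons. A supercharacter theory $\mathsf{S}$ of $G$ is a partition supercharacter theory if and only if $\mathsf{S}_{\mathcal{P}}\preccurlyeq\mathsf{S}$. In particular, the set of partition supercharacter theories of $G$ is an interval in the lattice of supercharacter theories of $G$.
   Context: A supercharacter theory of a finite group $G$ is a pair $\mathsf{S}=(\mathcal{X},\mathcal{K})$, where $\mathcal{X}$ is a partition of $\mathrm{Irr}(G)$ and $\mathcal{K}$ is a partition of $G$, such that $|\mathcal{X}|=|\mathcal{K}|$, $\{1\}\in\mathcal{K}$, and for every $X\in\mathcal{X}$ there is a (nonzero) character $\xi_X$ whose irreducible constituents lie in $X$ and which is constant on each part of $\mathcal{K}$. The parts of $\mathcal{K}$ are the $\mathsf{S}$-classes (superclasses). A supercharacter theory is uniquely determined by its superclasses. The partial order on supercharacter theories of $G$ is: $\mathsf{S}\preccurlyeq\mathsf{T}$ if every $\mathsf{T}$-class is a union of $\mathsf{S}$-classes; with this order the set of supercharacter theories of $G$ is a lattice. Let $H_1,\dots,H_{p+1}$ be the nontrivial proper subgroups of $G=C_p\times C_p$. For $I\subseteq\{1,\dots,p+1\}$ put $N_I=\bigcup_{i\in I}(H_i\setminus\{1\})$. For a partition $\mathcal{Q}$ of $\{1,\dots,p+1\}$, the sets $N_I$, $I\in\mathcal{Q}$, are the nonidentity superclasses of a supercharacter theory $\mathsf{S}_{\mathcal{Q}}$ of $G$; a partition supercharacter theory is one of the form $\mathsf{S}_{\mathcal{Q}}$.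 *)

(* Defs.v *)
From HB Require Import structures.
From mathcomp Require Import all_boot all_order all_algebra all_fingroup.
From mathcomp Require Import all_solvable all_field all_character.

Set Implicit Arguments.
Unset Strict Implicit.
Unset Printing Implicit Defensive.

Import GroupScope.

(* [irr_constt xi] is the set of irreducible constituents of [xi]; since       *)
(* [0 \is a character] holds in MathComp, nonvanishing is required separately. *)
Definition supercharacter_axiom (gT : finGroupType) (G : {group gT})
    (XX : {set {set Iirr G}}) (KK : {set {set gT}}) : Prop :=
  [/\ partition XX [set: Iirr G], partition KK G, #|XX| = #|KK|,
      [set 1] \in KK
    & forall X : {set Iirr G}, X \in XX ->
        exists xi : 'CF(G),
          [/\ xi \is a character, xi != 0%R, {subset irr_constt xi <= X}
            & forall K : {set gT}, K \in KK ->
                {in K &, forall x y, xi x = xi y}]].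

Record supercharacter_theory (gT : finGroupType) (G : {group gT}) :=
  SupercharacterTheory {
    irr_parts : {set {set Iirr G}};
    superclasses : {set {set gT}};
    supercharacterP : supercharacter_axiom irr_parts superclasses
  }.

Definition sct_le (gT : finGroupType) (G : {group gT})
    (S T : supercharacter_theory G) : Prop :=
  forall L : {set gT}, L \in superclasses T ->
    exists2 B : {set {set gT}}, B \subset superclasses S & L = cover B.

Definition sct_interval (gT : finGroupType) (G : {group gT})
    (D : supercharacter_theory G -> Prop) : Prop :=
  exists A B : supercharacter_theory G,
    sct_le A B /\ forall S, D S <-> sct_le A S /\ sct_le S B.

(* The set [{1, ..., n}] is rendered as ['I_n]. *)
Definition enum_nontrivial_proper (gT : finGroupType) (G : {group gT})
    (n : nat) (H : 'I_n -> {group gT}) : Prop :=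
  injective H /\
  forall K : {group gT},
    (exists i, H i = K) <-> K :!=: 1 /\ K \proper G.

Definition subgroups_union (gT : finGroupType) (n : nat)
    (H : 'I_n -> {group gT}) (I : {set 'I_n}) : {set gT} :=
  \bigcup_(i in I) (H i)^#.

(* [S] is the theory S_Q. A supercharacter theory is determined by its         *)
(* superclasses, so it is enough to prescribe these.                           *)
Definition is_sct_of (gT : finGroupType) (G : {group gT}) (n : nat)
    (H : 'I_n -> {group gT}) (Q : {set {set 'I_n}})
    (S : supercharacter_theory G) : Prop :=
  superclasses S = [set 1] |: [set subgroups_union H I | I in Q].

Definition partition_sct (gT : finGroupType) (G : {group gT}) (n : nat)
    (H : 'I_n -> {group gT}) (S : supercharacter_theory G) : Prop :=
  exists2 Q : {set {set 'I_n}}, partition Q [set: 'I_n] & is_sct_of H Q S.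

Definition singletons (n : nat) : {set {set 'I_n}} :=
  [set [set i] | i : 'I_n].

(* Main.v *)
Require Import Defs.
From mathcomp Require Import all_boot all_order all_algebra all_fingroup.
From mathcomp Require Import all_solvable all_field all_character.

Import GroupScope.

(** The nontrivial proper subgroups of G, called lines below, are the p + 1
subgroups of order p; any two of them meet trivially, and since G is not cyclic
every nonidentity element lies on exactly one of them ([mem_line]). Dually, the
kernel of a nonprincipal irreducible character of G is a line ([irr_ker_line]),
because G is abelian and a faithful irreducible character would make it cyclic.
So both the nonidentity elements of G and the nonprincipal irreducible
characters are fibred over the set of lines.

Every partition Q of the set of lines pulls back along these two maps to
partitions of G and of Irr(G), each with one more part than Q: this is the
theory S_Q ([partition_sct_exists]). The character attached to a block I is the
sum over the lines L in I of the permutation character of G on G / L minus the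
principal character. The constituents of a summand are the nonprincipal
characters with kernel L. At a nonidentity element lying on the line M, the
summand is p - 1 if L = M and -1 otherwise, so the value of the sum depends only
on whether M belongs to I.

If the classes of S are unions of classes of S_P, with P the partition into
singletons, then two nonidentity elements on the same line have the same
S-class. Hence the S-classes other than {1} are pulled back from the set of
lines, and the induced partition Q of that set gives S = S_Q
([ge_partition_sct]). Conversely every N_I is the union of the classes of S_P
that come from the lines in I ([partition_sct_ge]).

Finally, the theory of the one-block partition, with classes {1} and G - {1},
lies above every supercharacter theory ([sct_le_coarsest]), so that the
partition theories form the interval from S_P to this theory. *)

Set Implicit Arguments.
Unset Strict Implicit.
Unset Printing Implicit Defensive.

(** * Pointed fibre partitions *)

Section FibrePartition.

Variables (T : finType) (n : nat).
Implicit Types (D : {set T}) (e : T) (f : T -> 'I_n) (Q : {set {set 'I_n}}).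

Definition fibre_over D e f (I : {set 'I_n}) : {set T} :=
  [set x in D :\ e | f x \in I].

(** The same construction serves for classes ([e] the identity of G) and for
characters ([e] the principal one), which is why the base point is kept apart
in a part of its own. *)
Definition fibre_parts D e f Q : {set {set T}} :=
  [set e] |: [set fibre_over D e f I | I in Q].

(** Surjectivity of [f] off the base point makes the fibres over distinct blocks
nonempty and distinct; this is what makes the partitions of G and of Irr(G)
induced by one [Q] have the same number of parts. *)
Lemma fibre_partsP D e f Q :
    e \in D -> (forall i, exists2 x, x \in D :\ e & f x = i) ->
    partition Q [set: 'I_n] ->
  partition (fibre_parts D e f Q) D /\ #|fibre_parts D e f Q| = #|Q|.+1.
Proof.
move=> De f_onto /and3P[/eqP covQ tiQ Q0].
have Qnt I : I \in Q -> exists i, i \in I.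
  by move=> QI; apply/set0Pn; apply: contraNneq Q0 => <-.
have neq_e I : [set e] != fibre_over D e f I.
  by apply/eqP => /setP/(_ e); rewrite !inE eqxx.
split; last first.
  rewrite cardsU1 card_in_imset => [|I J QI QJ eqIJ]; last first.
    have [i Ii] := Qnt I QI; have [x Dx fx] := f_onto i.
    have /setP/(_ x) := eqIJ; rewrite !inE /= -in_setD1 Dx fx Ii /= => /esym Ji.
    by rewrite -(def_pblock tiQ QI Ii) (def_pblock tiQ QJ Ji).
  by case: imsetP => [[I _ /eqP] | //]; rewrite (negPf (neq_e I)).
apply/and3P; split.
- rewrite eqEsubset; apply/andP; split.
    apply/bigcupsP=> B /setU1P[-> | /imsetP[I _ ->]]; first by rewrite sub1set.
    by apply/subsetP=> x; rewrite !inE => /andP[/andP[]].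
  apply/subsetP=> x Dx; apply/bigcupP; have [-> | ex] := eqVneq x e.
    by exists [set e]; rewrite ?inE ?eqxx.
  have Cx : f x \in cover Q by rewrite covQ inE.
  exists (fibre_over D e f (pblock Q (f x))).
    by rewrite setU1r // imset_f // pblock_mem.
  by rewrite !inE ex Dx mem_pblock.
- apply/trivIsetP=> A B /setU1P[-> | /imsetP[I QI ->]].
    case/setU1P=> [-> | /imsetP[J QJ ->]]; first by rewrite eqxx.
    by rewrite disjoints1 !inE eqxx.
  case/setU1P=> [-> | /imsetP[J QJ ->] neqIJ].
    by rewrite disjoint_sym disjoints1 !inE eqxx.
  apply/pred0P=> x; rewrite !inE; apply: contraNF neqIJ.
  case/andP=> /andP[_ Ix] /andP[_ Jx].
  by rewrite -(def_pblock tiQ QI Ix) (def_pblock tiQ QJ Jx).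
- apply/setU1P=> -[/esym/eqP | /imsetP[I QI eqI]].
    by apply/negP/set0Pn; exists e; rewrite set11.
  have [i Ii] := Qnt I QI; have [x Dx fx] := f_onto i.
  by have := in_set0 x; rewrite eqI inE Dx fx Ii.
Qed.

End FibrePartition.

(** * Lines of an elementary abelian group of rank two *)

Section RankTwo.

Variables (p : nat) (p_prime : prime p) (gT : finGroupType) (G : {group gT}).
Hypothesis oG : #|G| = (p ^ 2)%N.
Variable H : 'I_p.+1 -> {group gT}.
Hypothesis H_enum : enum_nontrivial_proper G H.

Let H_inj : injective H. Proof. by case: H_enum. Qed.

Lemma line_nontrivial i : H i :!=: 1.
Proof. by case: H_enum => _ /(_ (H i))[[|]]; first by exists i. Qed.

Lemma line_proper i : H i \proper G.
Proof. by case: H_enum => _ /(_ (H i))[[|]]; first by exists i. Qed.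

Lemma line_index (K : {group gT}) :
  K :!=: 1 -> K \proper G -> exists i, H i = K.
Proof. by move=> K1 KG; case: H_enum => _ /(_ K)[_]; apply. Qed.

Lemma rank2_abelian : abelian G.
Proof. exact: card_p2group_abelian oG. Qed.

Lemma card_line i : #|H i| = p.
Proof.
have sHG := proper_sub (line_proper i).
have /(dvdn_pfactor _ _ p_prime)[k _ oH] : #|H i| %| p ^ 2.
  by rewrite -oG cardSg.
have := proper_card (line_proper i); have := line_nontrivial i.
rewrite trivg_card1 oH oG; case: k {oH} => [|[|k]] //=.
by rewrite ltn_exp2l ?prime_gt1.
Qed.

Lemma line_normal i : H i <| G.
Proof. by rewrite -sub_abelian_normal ?rank2_abelian ?proper_sub ?line_proper. Qed.

Lemma index_line i : #|G : H i| = p.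
Proof.
by rewrite -divgS ?proper_sub ?line_proper // oG card_line mulKn ?prime_gt0.
Qed.

(** A cyclic group has at most one subgroup of each order, while there are
p + 1 > 1 lines, all of order p. *)
Lemma rank2_noncyclic : ~~ cyclic G.
Proof.
apply/negP=> cycG.
have := eq_subG_cyclic cycG (proper_sub (line_proper ord0))
  (proper_sub (line_proper ord_max)).
rewrite !card_line eqxx => /eqP/group_inj/H_inj/(congr1 val) /= p0.
by have := prime_gt0 p_prime; rewrite -p0.
Qed.

Lemma lines_meet x i j : x != 1 -> x \in H i -> x \in H j -> i = j.
Proof.
move=> x1 Hix Hjx; apply: H_inj; apply/eqP.
apply: contraNT x1 => neq; rewrite -in_set1 -set1gE.
rewrite -(@prime_TIg _ (H i) (H j)) ?card_line ?inE ?Hix //.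
apply: contra neq => sub; rewrite -val_eqE eqEcard sub /=.
by rewrite !card_line.
Qed.

Lemma mem_some_line x : x \in G -> x != 1 -> exists i, x \in H i.
Proof.
move=> Gx x1; have [||i Hi] := @line_index <[x]>; first by rewrite cycle_eq1.
  rewrite properE cycle_subG Gx; apply: contra rank2_noncyclic => sGx.
  rewrite (_ : G :=: <[x]>) ?cycle_cyclic //.
  by apply/eqP; rewrite eqEsubset sGx cycle_subG.
by exists i; rewrite Hi cycle_id.
Qed.

(** The line is unique at a nonidentity element of G; elsewhere the value is
junk. *)
Definition line_of (x : gT) : 'I_p.+1 := odflt ord0 [pick i | x \in H i].

Lemma mem_line x i : x \in G -> x != 1 -> (x \in H i) = (line_of x == i).
Proof.
move=> Gx x1; have [j Hj] := mem_some_line Gx x1.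
rewrite /line_of; case: pickP => [k Hk | /(_ j)]; last by rewrite Hj.
by apply/idP/eqP=> [Hi | <- //]; apply: lines_meet x1 Hk Hi.
Qed.

Lemma line_of_onto i : exists2 x, x \in G^# & line_of x = i.
Proof.
have /trivgPn[x Hx x1] := line_nontrivial i.
have Gx : x \in G := subsetP (proper_sub (line_proper i)) x Hx.
by exists x; [rewrite !inE x1 | apply/eqP; rewrite -mem_line].
Qed.

Lemma subgroups_union_fibre I :
  subgroups_union H I = fibre_over G 1 line_of I.
Proof.
apply/setP=> x; apply/bigcupP/idP=> [[i Ii] | ].
  rewrite !inE => /andP[x1 Hx].
  have Gx : x \in G := subsetP (proper_sub (line_proper i)) x Hx.
  by move: (Hx); rewrite mem_line // => /eqP->; rewrite x1 Gx.
rewrite !inE => /andP[/andP[x1 Gx] Ix].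
by exists (line_of x) => //; rewrite !inE x1 mem_line /=.
Qed.

(** * Characters attached to the lines *)

(** The kernel is proper because the character is not principal. It is
nontrivial because a group with a faithful irreducible character has a cyclic
centre, and here the centre is all of G, which is not cyclic. *)
Lemma irr_ker_line (j : Iirr G) :
  j != 0%R -> exists i, H i :=: cfker ('chi_j)%R.
Proof.
move=> j0; have [||i Hi] := @line_index (cfker ('chi_j)%R)%G.
- apply: contra rank2_noncyclic => /eqP ker1.
  have := @irr_faithful_center _ G j; rewrite (center_idP rank2_abelian).
  by apply; rewrite /cfaithful /= ker1.
- by rewrite properE cfker_sub subGcfker.
by exists i; rewrite Hi.
Qed.

Definition ker_line (j : Iirr G) : 'I_p.+1 :=
  odflt ord0 [pick i | H i :==: cfker ('chi_j)%R].

Lemma sub_cfker_line (j : Iirr G) i :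
  j != 0%R -> H i \subset cfker ('chi_j)%R -> ker_line j = i.
Proof.
move=> j0 sub; have [k Hk] := irr_ker_line j0.
have Hi : H i :=: cfker ('chi_j)%R.
  by apply/eqP; rewrite eqEcard sub -Hk !card_line leqnn.
rewrite /ker_line; case: pickP => [l /eqP Hl | /(_ i)]; last by rewrite Hi eqxx.
by apply: H_inj; apply: val_inj; rewrite /= Hl Hi.
Qed.

(** The permutation character of G on G / H i, less its principal constituent:
it turns out to be the sum of the characters with kernel H i. *)
Definition line_char i : 'CF(G) := ('Ind[G, H i] 1 - 1)%R.

Lemma line_charE i x :
  x \in G -> line_char i x = (p%:R * (x \in H i)%:R - 1)%R.
Proof.
move=> Gx; rewrite /line_char cfInd_cfun1 ?line_normal // index_line.
by rewrite !cfunE cfuniE ?line_normal // cfun1E Gx.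
Qed.

Lemma cfdot_Ind1_1 i : ('['Ind[G, H i] 1, 1]_G = 1)%R.
Proof.
rewrite -Frobenius_reciprocity cfRes_cfun1 ?proper_sub ?line_proper //.
exact: cfnorm1.
Qed.

(** By Frobenius reciprocity the principal character is a constituent of the
induced character, so subtracting it leaves a character. *)
Lemma line_char_character i : line_char i \is a character.
Proof.
have Nind : ('Ind[G, H i] 1)%R \is a character by rewrite cfInd_char ?cfun1_char.
have /(constt_charP _ Nind)[chi Nchi def_ind] :
    (0%R : Iirr G) \in irr_constt ('Ind[G, H i] 1)%R.
  by rewrite irr_consttE irr0 cfdot_Ind1_1 GRing.oner_eq0.
by rewrite /line_char def_ind irr0 GRing.addrC GRing.addKr.
Qed.

(** The principal character has multiplicity 1 in the induced character, so it
has been removed entirely. The other constituents are trivial on H i because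
the whole character takes there its value at the identity. *)
Lemma line_char_constt i (j : Iirr G) :
  j \in irr_constt (line_char i) -> j != 0%R /\ ker_line j = i.
Proof.
move=> jP.
have j0 : j != 0%R.
  apply: contraTneq jP => ->; rewrite irr_consttE irr0 negbK cfdotBl.
  by rewrite cfdot_Ind1_1 cfnorm1 GRing.subrr.
split=> //; apply: sub_cfker_line j0 _.
apply: subset_trans (cfker_constt (line_char_character i) jP).
apply/subsetP=> x Hx.
have Gx : x \in G := subsetP (proper_sub (line_proper i)) x Hx.
rewrite cfkerEchar ?line_char_character // inE Gx.
by rewrite !line_charE ?Hx ?group1 ?eqxx.
Qed.

Lemma line_char_sum1_neq0 (I : {set 'I_p.+1}) :
  I != set0 -> (\sum_(i in I) line_char i)%R 1 != 0%R.
Proof.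
move=> I0; rewrite sum_cfunE (eq_bigr (fun=> (p%:R - 1)%R)) => [|i _].
  rewrite GRing.sumr_const Num.Theory.mulrn_eq0 cards_eq0 (negPf I0) /=.
  by rewrite GRing.subr_eq0 Num.Theory.pnatr_eq1 neq_ltn prime_gt1 ?orbT.
by rewrite line_charE ?group1 // GRing.mulr1.
Qed.

(** A line character is nonzero, and any of its constituents is a witness. *)
Lemma ker_line_onto i : exists2 j, j \in [set: Iirr G] :\ 0%R & ker_line j = i.
Proof.
have nz : line_char i != 0%R.
  have := @line_char_sum1_neq0 [set i]; rewrite big_set1 -cards_eq0 cards1.
  by move/(_ isT); apply: contraNneq => ->; rewrite cfunE.
have [j /line_char_constt[j0 ji]] := neq0_has_constt nz.
by exists j; rewrite ?inE ?j0.
Qed.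

(** * Partition supercharacter theories *)

(** The parts of Irr(G) pull back [Q] along [ker_line], the classes pull it back
along [line_of], and the character of a block is the sum of its line
characters. *)
Lemma partition_sct_exists (Q : {set {set 'I_p.+1}}) :
  partition Q [set: 'I_p.+1] ->
  exists S : supercharacter_theory G, is_sct_of H Q S.
Proof.
move=> partQ.
have [partX cardX] := fibre_partsP (in_setT 0%R) ker_line_onto partQ.
have [partK cardK] := fibre_partsP (group1 G) line_of_onto partQ.
suff ax : supercharacter_axiom
    (fibre_parts [set: Iirr G] 0%R ker_line Q) (fibre_parts G 1 line_of Q).
  exists (SupercharacterTheory ax); rewrite /is_sct_of /= /fibre_parts.
  by congr (_ |: _); apply: eq_imset => I; rewrite subgroups_union_fibre.
split=> //; [by rewrite cardX cardK | exact: setU11 |].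
move=> X /setU1P[-> | /imsetP[I QI ->]].
  exists 1%R; split; rewrite ?cfun1_char //.
  - by rewrite -irr0 irr_neq0.
  - by move=> j; rewrite -irr0 constt_irr !inE.
  - move=> K KK x y Kx Ky; rewrite !cfun1E.
    have KG z : z \in K -> z \in G.
      by move=> Kz; rewrite -(cover_partition partK); apply/bigcupP; exists K.
    by rewrite !KG.
have I0 : I != set0 by case/and3P: partQ => _ _; apply: contraNneq => <-.
exists (\sum_(i in I) line_char i)%R; split.
- by apply: GRing.rpred_sum => i _; apply: line_char_character.
- by apply: contraNneq (line_char_sum1_neq0 I0) => ->; rewrite cfunE.
- move=> j; rewrite irr_consttE cfdot_suml => nz.
  have [i /andP[Ii ij]] :
      exists i, (i \in I) && ('[line_char i, 'chi_j]%R != 0%R).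
    apply/existsP; apply: contraR nz; rewrite negb_exists => /forallP z.
    by rewrite big1 // => i Ii; apply/eqP; have := z i; rewrite Ii negbK.
  have [j0 ji] : j != 0%R /\ ker_line j = i.
    by apply: line_char_constt; rewrite irr_consttE.
  by rewrite !inE j0 ji Ii.
have valE x : x \in G^# -> (\sum_(i in I) line_char i)%R x
    = (\sum_(i in I) (p%:R * (line_of x == i)%:R - 1))%R.
  rewrite 2!inE => /andP[x1 Gx]; rewrite sum_cfunE; apply: eq_bigr => i _.
  by rewrite line_charE // mem_line.
move=> K /setU1P[-> | /imsetP[J QJ ->]] x y.
  by move/set1P=> -> /set1P->.
rewrite !in_set => /andP[Gx Jx] /andP[Gy Jy].
rewrite !valE ?in_set // !GRing.sumrB -!GRing.mulr_sumr.
(* The values at x and y differ only in the number of lines of I through each,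
   which is 1 if J = I and 0 otherwise, since distinct blocks are disjoint. *)
congr (_ * _ - _)%R.
case/and3P: partQ => _ tiQ _.
have cnt k : k \in J ->
    (\sum_(i in I) (k == i)%:R)%R = (I == J)%:R%R :> algC.
  move=> Jk; have -> : (I == J) = (k \in I).
    apply/eqP/idP=> [-> // | Ik].
    by rewrite -(def_pblock tiQ QI Ik) (def_pblock tiQ QJ Jk).
  have [Ik | Ik] := boolP (k \in I).
    rewrite (bigD1 k) //= eqxx big1 ?GRing.addr0 // => i /andP[_].
    by rewrite eq_sym => /negPf->.
  rewrite big1 // => i Ii; case: eqP => // ki; by rewrite ki Ii in Ik.
by rewrite !cnt.
Qed.

(** * The order on supercharacter theories *)

Lemma partition_sct_ge (SP S : supercharacter_theory G) :
  is_sct_of H (singletons p.+1) SP -> partition_sct H S -> sct_le SP S.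
Proof.
move=> defP [Q _ defQ] L; rewrite defQ => /setU1P[-> | /imsetP[I _ ->]].
  exists [set [set 1]]; last by rewrite /cover big_set1.
  by rewrite sub1set defP setU11.
exists [set (H i)^# | i in I]; last by rewrite cover_imset.
apply/subsetP=> _ /imsetP[i Ii ->]; rewrite defP setU1r //.
apply/imsetP; exists [set i]; first by rewrite imset_f.
by rewrite /subgroups_union big_set1.
Qed.

(** The S-class of a nonidentity element depends only on the line through it,
since a class of S containing one nonidentity element of a line contains them
all. The required partition of the lines is therefore the one induced by the
map [g] sending a line to its common S-class. *)
Lemma ge_partition_sct (SP S : supercharacter_theory G) :
  is_sct_of H (singletons p.+1) SP -> sct_le SP S -> partition_sct H S.
Proof.
move=> defP leS.
have [_ partK _ K1 _] := supercharacterP S.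
set KK := superclasses S in partK K1 *.
have tiK := partition_trivIset partK.
have covK x : x \in G -> x \in cover KK by rewrite (cover_partition partK).
have same x y : x \in G^# -> y \in G^# -> line_of x = line_of y ->
    pblock KK x = pblock KK y.
  rewrite 4!inE => /andP[x1 Gx] /andP[y1 Gy] xy.
  have Kx := pblock_mem (covK x Gx); have [B sB defL] := leS _ Kx.
  have : x \in pblock KK x by rewrite mem_pblock covK.
  rewrite {1}defL => /bigcupP[C BC Cx].
  have := subsetP sB C BC; rewrite defP => /setU1P[C1 | ].
    by move: Cx; rewrite C1 inE (negPf x1).
  case/imsetP=> J _ defC; move: Cx; rewrite defC subgroups_union_fibre.
  rewrite !inE x1 Gx xy /= => Jy.
  apply/esym/same_pblock => //; rewrite defL; apply/bigcupP; exists C => //.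
  by rewrite defC subgroups_union_fibre !inE y1 Gy.
pose g i := pblock KK (odflt 1 [pick x in G^# | line_of x == i]).
have gE x : x \in G^# -> g (line_of x) = pblock KK x.
  move=> Gx; rewrite /g; case: pickP => [y /andP[Gy /eqP xy] | /(_ x)] /=.
    exact: same.
  by rewrite Gx eqxx.
exists (preim_partition g setT); first exact: preim_partitionP.
have UE x : x \in G^# ->
    subgroups_union H [set k in setT | g (line_of x) == g k] = pblock KK x.
  move=> Gx; rewrite subgroups_union_fibre; apply/setP=> y.
  have Gx' : x \in G by case/setD1P: Gx.
  have x1 : x != 1 by case/setD1P: Gx.
  have [Gy | nGy] := boolP (y \in G^#).
    by rewrite in_set Gy !inE !gE // eq_pblock ?covK.
  rewrite in_set (negPf nGy) /=; apply/esym/negP=> xy.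
  (* The class of x is inside G and avoids 1, which has a class of its own. *)
  case/negP: nGy; rewrite !inE; apply/andP; split.
    apply: contraNneq x1 => y1; rewrite -in_set1 -(def_pblock tiK K1 (set11 1)).
    by rewrite -y1 (same_pblock tiK xy) mem_pblock covK.
  rewrite -(cover_partition partK); apply/bigcupP.
  by exists (pblock KK x); rewrite ?pblock_mem ?covK.
apply/setP=> L; apply/idP/setU1P=> [KL | [-> // | ]].
  have [L1 | L1] := boolP (1 \in L).
    by left; rewrite -(def_pblock tiK KL L1) (def_pblock tiK K1 (set11 1)).
  have /set0Pn[x Lx] : L != set0.
    by case/and3P: partK => _ _; apply: contraNneq => <-.
  have Gx : x \in G^#.
    rewrite !inE (contraNneq _ L1) => [|<- //].
    by rewrite -(cover_partition partK); apply/bigcupP; exists L.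
  right; apply/imsetP; exists [set k in setT | g (line_of x) == g k].
    exact: imset_f.
  by rewrite UE // (def_pblock tiK KL Lx).
case/imsetP=> _ /imsetP[i _ ->] ->.
have [x Gx <-] := line_of_onto i.
by rewrite UE // pblock_mem // covK //; case/setD1P: Gx.
Qed.

(** Its classes are {1} and G - {1}, and {1} is a class of every theory. *)
Lemma sct_le_coarsest (S T : supercharacter_theory G) :
  is_sct_of H [set [set: 'I_p.+1]] T -> sct_le S T.
Proof.
have [_ partK _ K1 _] := supercharacterP S.
have tiK := partition_trivIset partK.
move=> defT L; rewrite defT => /setU1P[-> | ].
  by exists [set [set 1]]; rewrite ?sub1set // /cover big_set1.
rewrite imset_set1 => /set1P->.
exists (superclasses S :\ [set 1]); first exact: subD1set.
rewrite subgroups_union_fibre; apply/setP=> x; rewrite in_set in_setT andbT.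
apply/setD1P/bigcupP=> [[x1 Gx] | [B /setD1P[B1 KB] Bx]].
  have Cx : x \in cover (superclasses S) by rewrite (cover_partition partK).
  exists (pblock (superclasses S) x); last by rewrite mem_pblock.
  rewrite in_setD1 pblock_mem // andbT; apply: contraNneq x1 => Px.
  by rewrite -in_set1 -Px mem_pblock.
split; last by rewrite -(cover_partition partK); apply/bigcupP; exists B.
apply: contraNneq B1 => x1; apply/eqP; rewrite -(def_pblock tiK KB Bx) x1.
exact: def_pblock tiK K1 (set11 1).
Qed.

End RankTwo.

Lemma singletons_partition n : partition (singletons n) [set: 'I_n].
Proof.
have E i : [set k in [set: 'I_n] | i == k] = [set i].
  by apply/setP=> k; rewrite !inE eq_sym.
rewrite (_ : singletons n = preim_partition id [set: 'I_n]) ?preim_partitionP //.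
by apply/setP=> B; apply/imsetP/imsetP=> -[i _ ->]; exists i; rewrite ?E ?inE.
Qed.

Lemma setT_partition n : partition [set [set: 'I_n.+1]] [set: 'I_n.+1].
Proof.
apply/and3P; split; first by rewrite /cover big_set1.
  by apply/trivIsetP=> A B /set1P-> /set1P->; rewrite eqxx.
by rewrite inE eq_sym; apply/set0Pn; exists ord0.
Qed.

Theorem lemma5p2 (p : nat) (p_prime : prime p)
    (gT : finGroupType) (G : {group gT})
    (G_CpCp : G \isog [set: 'Z_p * 'Z_p])
    (H : 'I_p.+1 -> {group gT}) (H_enum : enum_nontrivial_proper G H) :
  exists2 SP : supercharacter_theory G,
    is_sct_of H (singletons p.+1) SP
    & (forall S : supercharacter_theory G,
         partition_sct H S <-> sct_le SP S)
      /\ sct_interval (@partition_sct gT G p.+1 H).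
Proof.
have oG : #|G| = (p ^ 2)%N.
  rewrite (card_isog G_CpCp) cardsT card_prod.
  by rewrite card_ord Zp_cast ?prime_gt1 // mulnn.
have [SP defP] := partition_sct_exists p_prime oG H_enum (singletons_partition _).
have [ST defT] := partition_sct_exists p_prime oG H_enum (setT_partition _).
have iffP S : partition_sct H S <-> sct_le SP S.
  split; first exact: partition_sct_ge defP.
  exact: ge_partition_sct defP.
exists SP => //; split=> //; exists SP, ST; split.
  exact: sct_le_coarsest defT.
move=> S; split=> [/iffP leS | [leS _]]; last exact/iffP.
by split=> //; apply: sct_le_coarsest defT.
Qed.
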